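(* Let $n:\mathbb{N}\to\mathbb{N}$ be a function, and for each $d$ let $X_{d,n(d)}$ be an $n(d)$-element subset of $\{0,1\}^d$ chosen uniformly at random, and $P_{d,n(d)}:=\operatorname{conv} X_{d,n(d)}$. Denote by $\Delta_{d,n(d)}$ the density of the graph of $P_{d,n(d)}$. (i) If there is some $\varepsilon>0$ such that $n(d)\le(\sqrt{2}-\varepsilon)^d$ for all sufficiently large $d$, then $\lim_{d\to\infty}\mathbb{E}[\Delta_{d,n(d)}]=1$. (ii) If there is some $\varepsilon>0$ such that $n(d)\ge(\sqrt{2}+\varepsilon)^d$ for all sufficiently large $d$, then $\lim_{d\to\infty}\mathbb{E}[\Delta_{d,n(d)}]=0$.
   Context: The graph of a polytope $P$ has as nodes the vertices of $P$ and as edges the one-dimensional faces of $P$. The density of a graph $G=(V,E)$ is $|E|/\binom{|V|}{2}$. $\mathbb{E}$ denotes expected value. *)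

(* Defs.v *)
From HB Require Import structures.
From mathcomp Require Export all_boot all_order all_algebra.
From mathcomp Require Export finmap.
From mathcomp Require Export all_classical reals topology normedtype convex.
Export Order.TTheory GRing.Theory Num.Theory numFieldNormedType.Exports.

Set Implicit Arguments.
Unset Strict Implicit.
Unset Printing Implicit Defensive.

Local Open Scope classical_set_scope.
Local Open Scope ring_scope.

Section Polytopes.
Context {R : realType} {d : nat}.
Implicit Types (A P F : set 'rV[R]_d).

Definition conv_hull A : set 'rV[R]_d := smallest (@convex_set R 'rV[R]_d) A.

Definition affine_hull A : set 'rV[R]_d :=
  [set x | exists (m : nat) (p : 'I_m -> 'rV[R]_d) (a : 'I_m -> R),
      [/\ forall i, A (p i), \sum_i a i = 1 & x = \sum_i a i *: p i]].

(* The dimension of A is that of its affine hull, a translate of a linear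
   subspace; the empty set has no dimension. *)
Definition has_dim A (k : nat) : Prop :=
  exists (x : 'rV[R]_d) (U : {vspace 'rV[R]_d}),
    \dim U = k /\ affine_hull A = [set x + u | u in [set u | u \in U]].

(* Faces are cut out by the inequalities x *m c <= b valid on P; taking c = 0
   gives P itself and the empty face. *)
Definition is_face P F : Prop :=
  exists (c : 'cV[R]_d) (b : R),
    (forall x, P x -> (x *m c) 0 0 <= b) /\
    F = [set x | P x /\ (x *m c) 0 0 = b].

Definition vertices P : set 'rV[R]_d := [set v | is_face P [set v]].

Definition edges P : set (set 'rV[R]_d) :=
  [set F | is_face P F /\ has_dim F 1].

(* For a polytope both sets are finite, which is what makes fset_set (empty
   on infinite sets) meaningful; with fewer than two vertices this is 0 / 0. *)
Definition graph_density P : R :=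
  #|` fset_set (edges P)|%:R / 'C(#|` fset_set (vertices P)|, 2)%:R.

Definition cube_point (v : 'rV[bool]_d) : 'rV[R]_d :=
  map_mx (fun b : bool => b%:R) v.

Definition polytope01 (X : {set 'rV[bool]_d}) : set 'rV[R]_d :=
  conv_hull [set cube_point v | v in [set v | v \in X]].

End Polytopes.

(* The expectation of f at a uniformly random element of S. *)
Definition unif_expectation (R : realType) (T : finType) (S : {set T})
  (f : T -> R) : R := (\sum_(s in S) f s) / #|S|%:R.

Definition expected_density (R : realType) (d n : nat) : R :=
  unif_expectation [set X : {set 'rV[bool]_d} | #|X| == n]%SET
    (fun X => graph_density (polytope01 X)).

(* Main.v *)
Require Import Defs.
From mathcomp Require Import interval_inference ring lra zify sequences exp.

Set Implicit Arguments.
Unset Strict Implicit.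
Unset Printing Implicit Defensive.

(** Let N = 2^d. Two points v, w of X at Hamming distance k span a subcube F of
    dimension k, and E[Delta] is the mean over the pairs {v, w} of the
    probability p(v, w) that conv{v, w} is an edge, given that v, w lie in X.
    By Chebyshev's inequality, |2k - d| < d/q for all but a fraction O(q^2/d)
    of the pairs; q is a constant chosen in terms of epsilon.

    (i) If no third point of X lies in F, the pair is an edge; so
    1 - p(v, w) <= 2^k n/N, which is exponentially small when k is near d/2.

    (ii) If the pair is an edge, then X meets F only in v, w and in an open
    halfspace T whose boundary contains v and w. The antipodal map of F moves
    T off itself, so F \ T has at least 2^(k-1) points and X avoids all of them
    but v, w.
    For a fixed T this has probability at most exp(-(2^(k-1) - 2)(n - 2)/N), and
    there are at most (N + 1)^(d + 1) halfspaces T, because a halfspace is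
    determined by its number of points and their sum (Chow parameters). *)

(** * Faces of 0/1-polytopes *)

Section Faces.
Local Open Scope ring_scope.
Local Open Scope classical_set_scope.
Context {R : realType} {d : nat}.
Implicit Types (A P : set 'rV[R]_d) (x y u v w : 'rV[R]_d).

Lemma convex_setE A : @convex_set R 'rV[R]_d A <->
  forall x y (t : R), 0 < t -> t < 1 -> A x -> A y ->
    A (t *: x + (1 - t) *: y).
Proof.
split=> [cA x y t t0 t1 Ax Ay|cA].
  by have /set_mem := cA x y (Itv01 (ltW t0) (ltW t1)) (mem_set Ax) (mem_set Ay).
apply/convex_setW => x y /set_mem Ax /set_mem Ay k k0 k1.
by apply: mem_set; exact: cA.
Qed.

Lemma conv_hull_convex A x y (t : R) : 0 < t -> t < 1 ->
  conv_hull A x -> conv_hull A y -> conv_hull A (t *: x + (1 - t) *: y).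
Proof.
move=> t0 t1 Ax Ay B [cB AB]; move/convex_setE: (cB); apply => //.
- exact: Ax.
- exact: Ay.
Qed.

Lemma sub_conv_hull A : A `<=` conv_hull A.
Proof. by move=> x Ax B [_]; apply. Qed.

Lemma conv_hull_min A B :
    (forall x y (t : R), 0 < t -> t < 1 -> B x -> B y ->
      B (t *: x + (1 - t) *: y)) ->
  A `<=` B -> conv_hull A `<=` B.
Proof. by move=> cB AB x; apply; split=> //; apply/convex_setE. Qed.

Definition lform (c : 'cV[R]_d) x : R := (x *m c) 0 0.

Lemma lformD c x y : lform c (x + y) = lform c x + lform c y.
Proof. by rewrite /lform mulmxDl mxE. Qed.

Lemma lformZ c (t : R) x : lform c (t *: x) = t * lform c x.
Proof. by rewrite /lform -scalemxAl mxE. Qed.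

(** A combination with weights strictly between 0 and 1 of points where the form is at most [b]
    reaches [b] only if both points do. This makes the strengthened predicate convex, so it passes
    from [A] to the hull. *)
Lemma conv_hull_face A c (b : R) : (forall x, A x -> lform c x <= b) ->
  [set x | conv_hull A x /\ lform c x = b] =
  conv_hull [set x | A x /\ lform c x = b].
Proof.
move=> Ab; apply/seteqP; split=> x /=.
  case=> Ax; suff [_ H] : lform c x <= b /\ (lform c x = b ->
    conv_hull [set x | A x /\ lform c x = b] x) by [].
  move: x Ax; apply: (@conv_hull_min _ [set x | lform c x <= b /\
     (lform c x = b -> conv_hull [set x | A x /\ lform c x = b] x)]) => [x y t t0 t1|x Ax] /=.
    move=> [xb xA] [yb yA]; rewrite lformD !lformZ.
    have t1' : 0 < 1 - t by rewrite subr_gt0.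
    split; first by nra.
    move=> e; have xe : lform c x = b by nra.
    have ye : lform c y = b by nra.
    by apply: conv_hull_convex => //; auto.
  by split; [exact: Ab|move=> e; apply: sub_conv_hull].
apply: (@conv_hull_min _ [set x | conv_hull A x /\ lform c x = b]) => [{}x y t t0 t1|{}x] /=.
  move=> [Ax xb] [Ay yb]; split; first exact: conv_hull_convex.
  by rewrite lformD !lformZ xb yb; lra.
by case=> Ax xb; split=> //; exact: sub_conv_hull.
Qed.

Lemma conv_hull_le A c (b : R) : (forall x, A x -> lform c x <= b) ->
  forall x, conv_hull A x -> lform c x <= b.
Proof.
move=> Ab; apply: (@conv_hull_min _ [set x | lform c x <= b]) => //= x y t t0 t1 xb yb.
have t1' : 0 < 1 - t by rewrite subr_gt0.
by rewrite lformD !lformZ; nra.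
Qed.

Lemma conv_hull1 x : conv_hull [set x] = [set x].
Proof.
apply/seteqP; split; last exact: sub_conv_hull.
by apply: conv_hull_min => // y z t _ _ -> -> /=; rewrite -scalerDl subrKC scale1r.
Qed.

Lemma conv_hull0 : conv_hull set0 = set0 :> set 'rV[R]_d.
Proof. by apply/seteqP; split=> //; apply: conv_hull_min. Qed.

Lemma conv_hull2_sub x y : conv_hull [set x; y] `<=` [set x + t *: (y - x) | t in [set: R]].
Proof.
apply: conv_hull_min => [_ _ t t0 t1 [p _ <-] [q _ <-]|_ [->|->]] /=.
- exists (t * p + (1 - t) * q) => //.
  apply/rowP => i; rewrite !mxE; ring.
- by exists 0 => //; rewrite scale0r addr0.
- by exists 1 => //; rewrite scale1r subrKC.
Qed.

Lemma affine_hull_sub A B : A `<=` B -> affine_hull A `<=` affine_hull B.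
Proof. by move=> AB x [m [p [a [pA a1 ->]]]]; exists m, p, a; split=> // i; apply: AB. Qed.

Lemma sub_affine_hull A : A `<=` affine_hull A.
Proof.
move=> x Ax; exists 1%N, (fun=> x), (fun=> 1).
by split=> //; rewrite big_ord1 // scale1r.
Qed.

Lemma affine_hull_line x u :
  affine_hull [set x + t *: u | t in [set: R]] `<=` [set x + t *: u | t in [set: R]].
Proof.
move=> _ [m [p [a [pA a1 ->]]]].
have /choice[t tP] : forall i, exists t, p i = x + t *: u.
  by move=> i; have [t _ <-] := pA i; exists t.
exists (\sum_i a i * t i) => //.
under [RHS]eq_bigr do rewrite tP scalerDr scalerA.
by rewrite big_split/= -!scaler_suml a1 scale1r.
Qed.

Lemma affine_hull_line2 A x y (t : R) : A x -> A y ->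
  affine_hull A (x + t *: (y - x)).
Proof.
move=> Ax Ay; exists 2%N, (fun i => if i == 0 then x else y),
  (fun i => if i == 0 then 1 - t else t); split.
- by move=> i; case: ifP.
- by rewrite big_ord_recl big_ord1/= subrK.
- rewrite big_ord_recl big_ord1/=; apply/rowP => i; rewrite !mxE; ring.
Qed.

Lemma has_dim_conv2 x y : x != y -> has_dim (conv_hull [set x; y]) 1.
Proof.
move=> xy; exists x, <[y - x]>%VS; split.
  by rewrite dim_vline subr_eq0 eq_sym xy.
apply/seteqP; split=> [z|_ [u /vlineP[t ->] <-]].
  move/(affine_hull_sub (@conv_hull2_sub x y)) => /affine_hull_line[t _ <-].
  by exists (t *: (y - x)) => //=; rewrite memvZ // memv_line.
by apply: affine_hull_line2; apply: sub_conv_hull; [left|right].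
Qed.

(** The direction space is a line containing the nonzero vector [y - x], hence spanned by it. *)
Lemma has_dim1_collinear A x y z : has_dim A 1 -> A x -> A y -> A z ->
  x != y -> exists t : R, z = x + t *: (y - x).
Proof.
move=> [o [U [dU AU]]] Ax Ay Az xy.
have sub a b : A a -> A b -> b - a \in U.
  move=> /sub_affine_hull + /sub_affine_hull; rewrite AU => -[u uU <-] [v vU <-].
  by rewrite opprD addrACA subrr add0r rpredB.
have yxU := sub _ _ Ax Ay.
have /eqP UE : (<[y - x]> == U)%VS.
  by rewrite eqEdim -memvE yxU dU dim_vline subr_eq0 eq_sym xy.
have := sub _ _ Ax Az; rewrite -UE => /vlineP[t e].
by exists t; rewrite -e subrKC.
Qed.

Lemma has_dim1_two_points A : has_dim A 1 ->
  exists x y, [/\ A x, A y & x != y].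
Proof.
move=> [o [U [dU AU]]].
have [x Ax] : exists x, A x.
  have : affine_hull A o by rewrite AU; exists 0; rewrite /= ?mem0v ?addr0.
  (* A combination of no points is impossible, since the coefficients sum to 1. *)
  move=> [[|m] [p [a [pA a1 _]]]]; last by exists (p ord0).
  by move: a1; rewrite big_ord0 => /esym/eqP; rewrite oner_eq0.
case: (pselect (exists y, A y /\ x != y)) => [[y [Ay xy]]|nA].
  by exists x, y.
have AE : A `<=` [set x + t *: 0 | t in [set: R]].
  move=> y Ay; exists 0 => //; rewrite scaler0 addr0.
  by case: (eqVneq x y) => // xy; case: nA; exists y.
have U0 u : u \in U -> o + u = x.
  move=> uU; have : affine_hull A (o + u) by rewrite AU; exists u.
  by move=> /(affine_hull_sub AE)/affine_hull_line[t _ <-]; rewrite scaler0 addr0.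
have : U = 0%VS.
  apply/eqP; rewrite -subv0; apply/subvP => u uU; rewrite memv0.
  by apply/eqP/(addrI o); rewrite (U0 _ uU) (U0 _ (mem0v _)).
by move=> U00; move: dU; rewrite U00 dimv0.
Qed.

End Faces.

(** * Faces of a 0/1-polytope as subsets of its vertex set *)

Section CubePolytopes.
Local Open Scope ring_scope.
Context (R : realType) (d : nat).
Implicit Types (X A : {set 'rV[bool]_d}) (u v w : 'rV[bool]_d).
Local Notation cube := (@cube_point R d).
Local Notation "X %:pt" := ([set cube v | v in [set v | v \in X]])%classic
  (at level 2, format "X %:pt").

(** These sets [A] are the vertex sets of the faces of [polytope01 X], so that faces can be handled
    as finite sets. *)
Definition is_exposed X A : Prop := exists (c : 'cV[R]_d) (b : R),
  (forall u, u \in X -> lform c (cube u) <= b) /\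
  A = [set u in X | lform c (cube u) == b]%SET.

Lemma cube_point_inj : injective cube.
Proof.
move=> u v /rowP e; apply/rowP => i; have := e i; rewrite !mxE.
by case: (u 0 i); case: (v 0 i) => // /eqP; rewrite ?oner_eq0 // eq_sym oner_eq0.
Qed.

(** In a coordinate where [u] and [v] differ, the point on the line has the value [t] or [1 - t]; as
    this is 0 or 1, so is [t]. *)
Lemma cube_point_line u v w (t : R) : u != v ->
  cube w = cube u + t *: (cube v - cube u) -> w = u \/ w = v.
Proof.
move=> uv e.
have [i ui] : exists i, u 0 i != v 0 i.
  apply/existsP; apply: contraNT uv; rewrite negb_exists => /forallP h.
  by apply/eqP/rowP => i; apply/eqP; have := h i; rewrite negbK.
have : t = 0 \/ t = 1.
  have := congr1 (fun z : 'rV[R]_d => z 0 i) e; rewrite !mxE.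
  case: (u 0 i) (v 0 i) (w 0 i) ui => [] [] [] //= _ => h; [left|right|right|left]; lra.
case=> t01; [left|right]; apply: cube_point_inj; rewrite e t01.
  by rewrite scale0r addr0.
by rewrite scale1r subrKC.
Qed.

Lemma mem_conv_hull_pt X A u : is_exposed X A -> u \in X ->
  conv_hull A%:pt (cube u) -> u \in A.
Proof.
move=> [c [b [Xb ->]]] uX; rewrite inE uX /= => h.
suff -> : lform c (cube u) = b by [].
apply/eqP; rewrite eq_le Xb//=.
have : lform (- c) (cube u) <= - b.
  apply: conv_hull_le h => _ [v /= + <-]; rewrite inE => /andP[_ /eqP <-].
  by rewrite /lform mulmxN mxE.
by rewrite /lform mulmxN mxE lerN2.
Qed.

Lemma polytope_faceP X (F : set 'rV[R]_d) : is_face (polytope01 X) F <->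
  exists2 A, is_exposed X A & F = conv_hull A%:pt.
Proof.
have faceE c b : [set x | X%:pt x /\ lform c x = b]%classic =
    [set u in X | lform c (cube u) == b]%SET%:pt.
  apply/seteqP; split=> [_ [[u /= uX <-] e]|_ [u /= + <-]].
    by exists u => //=; rewrite inE uX e eqxx.
  by rewrite inE => /andP[uX /eqP e]; split => //; exists u.
have boundE c b : (forall u, u \in X -> lform c (cube u) <= b) ->
    forall x, X%:pt x -> lform c x <= b by move=> h _ [u uX <-]; exact: h.
split=> [[c [b [Pb ->]]]|[_ [c [b [Xb ->]]] ->]].
  have Xb u : u \in X -> lform c (cube u) <= b.
    by move=> uX; apply: Pb; apply: sub_conv_hull; exists u.
  exists [set u in X | lform c (cube u) == b]%SET; first by exists c, b.
  by rewrite -faceE; apply: conv_hull_face; exact: boundE.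
exists c, b; split; first exact: conv_hull_le (boundE _ _ Xb).
by rewrite -faceE; apply/esym; apply: conv_hull_face; exact: boundE.
Qed.

Lemma is_exposed_sub X A : is_exposed X A -> A \subset X.
Proof. by move=> [c [b [_ ->]]]; apply/fintype.subsetP => u; rewrite inE => /andP[]. Qed.

(** A face determines the points of [X] on it, which lets edges be counted as pairs of points. *)
Lemma conv_hull_pt_inj X A B : is_exposed X A -> is_exposed X B ->
  conv_hull A%:pt = conv_hull B%:pt -> A = B.
Proof.
move=> eA eB e; apply/eqP; rewrite finset.eqEsubset; apply/andP; split;
  apply/fintype.subsetP => u uA.
- apply: (mem_conv_hull_pt eB); first exact: (fintype.subsetP (is_exposed_sub eA)).
  by rewrite -e; apply: sub_conv_hull; exists u.
- apply: (mem_conv_hull_pt eA); first exact: (fintype.subsetP (is_exposed_sub eB)).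
  by rewrite e; apply: sub_conv_hull; exists u.
Qed.

Lemma pt1 v : [set v]%SET%:pt = [set cube v]%classic.
Proof.
apply/seteqP; split=> [_ [u /= + <-]|_ ->]; last by exists v; rewrite //= inE.
by rewrite inE => /eqP ->.
Qed.

Lemma pt2 v w : [set v; w]%SET%:pt = [set cube v; cube w]%classic.
Proof.
apply/seteqP; split=> [_ [u /= + <-]|_ [] ->]; last 2 first.
- by exists v; rewrite //= !inE eqxx.
- by exists w; rewrite //= !inE eqxx orbT.
by rewrite !inE => /orP[] /eqP ->; [left|right].
Qed.

Definition edge_pairs X : {set {set 'rV[bool]_d}} :=
  [set A | `[< is_exposed X A >] & #|A| == 2]%SET.

(** A line contains at most two cube points, so a one-dimensional face has exactly two points of
    [X]. *)
Lemma edges_polytope X : edges (polytope01 X) =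
  [set conv_hull A%:pt | A in [set A | A \in edge_pairs X]]%classic.
Proof.
apply/seteqP; split=> [F [/polytope_faceP[A eA ->] dF]|_ [A /= + <-]]; last first.
  rewrite inE => /andP[/asboolP eA /cards2P[v [w [vw AE]]]].
  split; first by apply/polytope_faceP; exists A.
  by rewrite AE pt2; apply: has_dim_conv2; rewrite (inj_eq cube_point_inj).
exists A => //=; rewrite inE; apply/andP; split; first exact/asboolP.
have [v vA] : exists v, v \in A.
  apply/finset.set0Pn/eqP => A0; have [x [y [+ _ _]]] := has_dim1_two_points dF.
  suff -> : A%:pt = set0 by rewrite conv_hull0.
  by rewrite A0; apply/seteqP; split=> // z [u /=]; rewrite inE.
have [w [wA vw]] : exists w, w \in A /\ v != w.
  apply: contrapT => nw; have AE : A = [set v]%SET.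
    apply/setP => u; rewrite inE; apply/idP/eqP => [uA|->//].
    by apply/eqP/negP => /negP uv; apply: nw; exists u; rewrite eq_sym.
  have [x [y [+ + /eqP]]] := has_dim1_two_points dF.
  by rewrite AE pt1 conv_hull1 => -> ->.
suff -> : A = [set v; w]%SET by rewrite cards2 vw.
apply/setP => u; rewrite !inE; apply/idP/idP => [uA|/orP[]/eqP->//].
have sA u' : u' \in A -> conv_hull A%:pt (cube u').
  by move=> u'A; apply: sub_conv_hull; exists u'.
have vw' : cube v != cube w by rewrite (inj_eq cube_point_inj).
have [t ut] := has_dim1_collinear dF (sA _ vA) (sA _ wA) (sA _ uA) vw'.
by have [->|->] := cube_point_line vw ut; rewrite eqxx ?orbT.
Qed.

(** The smallest face of the cube through [v] and [w]: the coordinates where they differ are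
    free. *)
Definition subcube (v w : 'rV[bool]_d) : {set 'rV[bool]_d} :=
  [set u : 'rV[bool]_d | [forall i, (v 0 i == w 0 i) ==> (u 0 i == v 0 i)]]%SET.

(** The form has coefficient 1 or -1 where [v] and [w] share the value 1 or 0, and coefficient 0
    elsewhere. It is maximised coordinate by coordinate, with equality exactly on the subcube. *)
Lemma subcube_exposed v w X : is_exposed X (X :&: subcube v w).
Proof.
pose s i : R := if v 0 i == w 0 i then (v 0 i)%:R *+ 2 - 1 else 0.
pose c : 'cV[R]_d := \col_i s i.
have le u i : (u 0 i)%:R * s i <= (v 0 i)%:R * s i ?=
    iff ((v 0 i == w 0 i) ==> (u 0 i == v 0 i)).
  rewrite /s; case: (v 0 i == w 0 i) => /=; last by rewrite !mulr0; split; rewrite ?eqxx.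
  case: (u 0 i) (v 0 i) => [] []; split=> /=; rewrite ?eqxx ?lexx ?mul0r ?mul1r //;
    apply/eqP => ?; lra.
have lfE u : lform c (cube u) = \sum_i (u 0 i)%:R * s i.
  by rewrite /lform mxE; apply: eq_bigr => i _; rewrite !mxE.
have lf u : lform c (cube u) <= lform c (cube v) ?= iff (u \in subcube v w).
  by rewrite !lfE inE; apply: leif_sum => i _; exact: le.
exists c, (lform c (cube v)); split=> [z _|]; first by rewrite lf.
by apply/setP => z; rewrite !inE; rewrite (lf z) inE.
Qed.

(** Every point [v] of [X] is a vertex because [subcube v v] is the single point [v]. *)
Lemma vertices_polytope X : vertices (polytope01 X) = X%:pt.
Proof.
apply/seteqP; split=> [x /polytope_faceP[A eA xE]|_ [v /= vX <-]].
  have [v vA] : exists v, v \in A.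
    apply/finset.set0Pn/eqP => A0; move: xE.
    suff -> : A%:pt = set0 by rewrite conv_hull0 => /seteqP[/(_ x erefl)].
    by rewrite A0; apply/seteqP; split=> // z [u /=]; rewrite inE.
  exists v => /=; first exact: (fintype.subsetP (is_exposed_sub eA)).
  have : [set x]%classic (cube v) by rewrite xE; apply: sub_conv_hull; exists v.
  by [].
apply/polytope_faceP; exists [set v]%SET; last by rewrite pt1 conv_hull1.
suff -> : [set v]%SET = X :&: subcube v v by exact: subcube_exposed.
apply/setP => u; rewrite !inE; apply/eqP/andP => [->|[_ /forallP h]].
  by split=> //; apply/forallP => i; rewrite eqxx.
by apply/rowP => i; have := h i; rewrite eqxx /= => /eqP.
Qed.

Lemma graph_density_polytope X :
  graph_density (polytope01 X) = #|edge_pairs X|%:R / 'C(#|X|, 2)%:R :> R.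
Proof.
rewrite /graph_density vertices_polytope edges_polytope.
have fin (T : finType) (S : {set T}) : finite_set [set x | x \in S]%classic.
  exact: finite_finpred.
have fsE (T : finType) (S : {set T}) x :
    (x \in fset_set [set x | x \in S]%classic) = (x \in S).
  by rewrite in_fset_set // mem_setE.
have card_fs (T : finType) (S : {set T}) : #|` fset_set [set x | x \in S]%classic| = #|S|.
  rewrite cardE; apply/perm_size/uniq_perm; rewrite ?fset_uniq ?enum_uniq // => x.
  by rewrite fsE mem_enum.
rewrite !fset_set_image // !card_in_imfset /=.
- by rewrite !card_fs.
- by move=> u v _ _; exact: cube_point_inj.
- move=> A B; rewrite !fsE !inE => /andP[/asboolP eA _] /andP[/asboolP eB _].
  exact: conv_hull_pt_inj eA eB.
Qed.

End CubePolytopes.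

(** * Counting subsets *)

Section Counting.
Variable T : finType.
Implicit Types A B X : {set T}.

Lemma disjoint_set0 X : [disjoint X & finset.set0].
Proof. by rewrite -setI_eq0 finset.setI0. Qed.

Lemma card_supersets A B m : [disjoint A & B] ->
  #|[set X : {set T} | [&& A \subset X, [disjoint X & B] & #|X| == #|A| + m]]|
  = 'C(#|T| - #|A| - #|B|, m).
Proof.
move=> AB; have dAB X : X \subset ~: (A :|: B) -> [disjoint A & X].
  move=> XAB; rewrite disjoint_sym finset.disjoints_subset; apply: fintype.subset_trans XAB _.
  by rewrite finset.setCS finset.subsetUl.
have cC : #|~: (A :|: B)| = #|T| - #|A| - #|B|.
  by rewrite cardsCs finset.setCK cardsU (disjoint_setI0 AB) cards0 subn0 subnDA.
rewrite -cC -cards_draws -(@card_in_imset _ _ (fun Y => A :|: Y)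
    [set Y : {set T} | (Y \subset ~: (A :|: B)) && (#|Y| == m)]); last first.
  move=> X Y; rewrite !inE => /andP[/dAB dX _] /andP[/dAB dY _] /setP e.
  apply/setP => x; have := e x; rewrite !inE; case: (boolP (x \in A)) => //= xA.
  by rewrite (disjointFr dX xA) (disjointFr dY xA).
congr #|pred_of_set _|; apply/setP => X; rewrite !inE; apply/and3P/imsetP.
  move=> [AX XB /eqP cX]; exists (X :\: A); last
    by rewrite -{1}(finset.setID X A) (finset.setIidPr AX).
  rewrite inE; apply/andP; split; last first.
    by rewrite cardsD (finset.setIidPr AX) cX addKn.
  rewrite finset.setCU finset.setDE finset.setIC finset.setIS //.
  by rewrite -finset.disjoints_subset.
move=> [Y]; rewrite inE => /andP[YAB /eqP cY] ->; split.
- exact: finset.subsetUl.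
- rewrite finset.disjoints_subset finset.subUset -finset.disjoints_subset AB /=.
  apply: fintype.subset_trans YAB _.
  by rewrite finset.setCS finset.subsetUr.
- by rewrite cardsU cY (disjoint_setI0 (dAB _ YAB)) cards0 subn0.
Qed.

Lemma leq_card_bigcup (I : finType) (P : pred I) (F : I -> {set T}) :
  #|\bigcup_(i | P i) F i| <= \sum_(i | P i) #|F i|.
Proof.
elim/big_ind2: _ => [|A a B b Aa Bb|//]; first by rewrite cards0.
exact: leq_trans (leq_card_setU _ _) (leq_add Aa Bb).
Qed.

(** Double counting; with [Q] the exposedness of [A] in [X], it exchanges the mean over [X] with a
    sum over pairs of cube points. *)
Lemma exchange_card_subsets (n : nat) (Q : {set T} -> {set T} -> bool) :
  \sum_(X in [set X : {set T} | #|X| == n])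
     #|[set A : {set T} | [&& A \subset X, #|A| == 2 & Q X A]]|
  = \sum_(A in [set A : {set T} | #|A| == 2])
     #|[set X : {set T} | [&& A \subset X, #|X| == n & Q X A]]|.
Proof.
under eq_bigr do rewrite -sum1_card.
under [RHS]eq_bigr do rewrite -sum1_card.
rewrite (exchange_big_dep (fun A => A \in [set A : {set T} | #|A| == 2])) /=; last first.
  by move=> X A; rewrite !inE => _ /and3P[].
apply: eq_bigr => A; rewrite inE => A2; apply: eq_bigl => X.
by rewrite !inE A2 /= andbCA.
Qed.

Lemma exchange_card_pairs n : 2 <= n ->
  'C(#|T|, n) * 'C(n, 2) = 'C(#|T|, 2) * 'C(#|T| - 2, n - 2).
Proof.
move=> n2; have := exchange_card_subsets n (fun _ _ => true).
under eq_bigr => X.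
  rewrite inE => /eqP Xn.
  have -> : [set A : {set T} | [&& A \subset X, #|A| == 2 & true]] =
      [set A : {set T} | (A \subset X) && (#|A| == 2)].
    by apply/setP => A; rewrite !inE andbT.
  rewrite cards_draws Xn; over.
under [X in _ = X]eq_bigr => A.
  rewrite inE => /eqP A2.
  have -> : [set X : {set T} | [&& A \subset X, #|X| == n & true]] =
    [set X : {set T} | [&& A \subset X, [disjoint X & finset.set0] & #|X| == #|A| + (n - 2)]].
    by apply/setP => X; rewrite !inE disjoint_set0 A2 subnKC ?andbT.
  rewrite card_supersets ?disjoint_set0 // cards0 subn0 A2; over.
rewrite !sum_nat_const.
have cd k : #|[set X : {set T} | #|X| == k]| = 'C(#|T|, k).
  by rewrite -[in RHS]cardsT -cards_draws; apply: eq_card => X; rewrite !inE finset.subsetT.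
by rewrite !cd.
Qed.

End Counting.

(** A random [m]-set among [N] points avoids [b] given ones with probability at most
    [(1 - b / N) ^ m], because [(N - b - i) / (N - i) <= (N - b) / N] for each factor. *)
Lemma bin_sub_le N b m : b <= N ->
  'C(N - b, m) * N ^ m <= 'C(N, m) * (N - b) ^ m.
Proof.
move=> bN; rewrite -(leq_pmul2r (fact_gt0 m)) mulnAC bin_ffact [leqRHS]mulnAC bin_ffact.
elim: m => [|m IH]; first by rewrite !ffactn0 !expn0.
rewrite !ffactnSr !expnSr mulnACA [leqRHS]mulnACA leq_mul //; nia.
Qed.

(** The ratio of the binomials is [(n - 2) / (N - 2)], the probability that a random [n]-set
    containing two given points contains a given third one. *)
Lemma bin_pred_le N n : 3 <= n -> n <= N ->
  'C(N - 3, n - 3) * N <= n * 'C(N - 2, n - 2).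
Proof.
move=> n3 nN; have := mul_bin_diag (N - 2) (n - 3).
have -> : (N - 2).-1 = N - 3 by lia.
have -> : (n - 3).+1 = n - 2 by lia.
by move=> e; rewrite -(@leq_pmul2l (N - 2)) ?mulnA ?e; nia.
Qed.

(** * Hamming distances in the cube *)

Section Cube.
Variable d : nat.
Implicit Types (u v w : 'rV[bool]_d) (S : {set 'I_d}) (X A : {set 'rV[bool]_d}).

Definition diffs v w : {set 'I_d} := [set i | v 0%R i != w 0%R i].

Definition flip v S : 'rV[bool]_d := (\row_i (v 0 i (+) (i \in S)))%R.

Lemma flipK v : cancel (flip v) (diffs v).
Proof.
by move=> S; apply/setP => i; rewrite !inE mxE; case: (v _ i); case: (i \in S).
Qed.

Lemma diffsK v : cancel (diffs v) (flip v).
Proof.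
by move=> w; apply/rowP => i; rewrite mxE inE; case: (v _ i); case: (w _ i).
Qed.

Lemma card_cube : #|{: 'rV[bool]_d}| = 2 ^ d.
Proof. by rewrite card_mx card_bool mul1n. Qed.

Lemma card_subcube v w : #|subcube v w| = 2 ^ #|diffs v w|.
Proof.
rewrite -card_powerset -(card_imset _ (can_inj (diffsK v))).
congr #|pred_of_set _|; apply/setP => S; rewrite inE; apply/imsetP/fintype.subsetP.
  move=> [u + ->] i; rewrite !inE => /forallP/(_ i).
  by case: (v 0%R i == w 0%R i) => //=; rewrite eq_sym => /eqP ->; rewrite eqxx.
move=> SD; exists (flip v S); last by rewrite flipK.
rewrite inE; apply/forallP => i; apply/implyP => vw; rewrite mxE.
by case: (boolP (i \in S)) => [/SD|]; rewrite ?inE ?vw ?addbF.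
Qed.

(** For a uniformly random [S] these are independent random signs. *)
Definition sgn_in S (i : 'I_d) : int := (if i \in S then 1 else -1)%R.

Lemma sum_sgn_in S : (\sum_i sgn_in S i = #|S|%:R *+ 2 - d%:R)%R.
Proof.
have -> : (\sum_i sgn_in S i = \sum_i ((i \in S)%:R *+ 2 - 1))%R.
  by apply: eq_bigr => i _; rewrite /sgn_in; case: (i \in S).
rewrite big_split /= sumrMnl sumr_const card_ord mulNrn.
congr (_ *+ 2 - _)%R.
rewrite -natr_sum -sum1_card [in RHS]big_mkcond; congr (_%:R)%R.
Qed.

(** For distinct [i] and [j], toggling the membership of [i] in [S] changes the sign of one factor
    only, so the sum is its own negative. *)
Lemma sum_sgn_in2 i j : (\sum_(S : {set 'I_d}) sgn_in S i * sgn_in S j =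
  (i == j)%:R * (2 ^ d)%:R)%R.
Proof.
have [->|ij] := eqVneq i j.
  rewrite mul1r -[in RHS](card_ord d) -cardsT -card_powerset -sum1_card natr_sum.
  have -> : powerset [set: 'I_d] = [set: {set 'I_d}].
    by apply/setP => S; rewrite !inE finset.subsetT.
  by apply: eq_big => [S|S _]; rewrite ?inE // /sgn_in; case: ifP.
rewrite mul0r; set x := (\sum_(S : _) _)%R; suff : (x = - x)%R by lia.
rewrite {1}/x.
pose t S := [set k | (k \in S) (+) (k == i)].
have tK : involutive t.
  by move=> S; apply/setP => k; rewrite !inE; case: (k \in S); case: (k == i).
rewrite /x [in RHS](reindex_inj (inv_inj tK)) -sumrN; apply: eq_bigr => S _.
rewrite /sgn_in !inE eqxx (negbTE (_ : j != i)) 1?eq_sym // addbF addbT.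
by case: (i \in S) => /=; rewrite ?mulN1r ?mul1r ?opprK.
Qed.

(** The variance of a sum of signs: in the expanded square only the diagonal terms survive. *)
Lemma sum_deviation2 :
  (\sum_(S : {set 'I_d}) (#|S|%:R *+ 2 - d%:R) ^+ 2 = (d * 2 ^ d)%:R :> int)%R.
Proof.
under eq_bigr do rewrite -sum_sgn_in expr2 mulr_suml.
under eq_bigr do under eq_bigr do rewrite mulr_sumr.
rewrite exchange_big /=; under eq_bigr do rewrite exchange_big /=.
under eq_bigr => i _.
  under eq_bigr do rewrite sum_sgn_in2.
  rewrite (bigD1 i) //= eqxx mul1r big1 ?addr0; first over.
  by move=> j ji; rewrite eq_sym (negbTE ji) mul0r.
by rewrite /= sumr_const card_ord natrM mulr_natl.
Qed.

(* One of the two truncated differences vanishes, so their sum is the absolute value *)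
Definition unbalanced q S := d <= q * ((2 * #|S| - d) + (d - 2 * #|S|)).

(** Chebyshev's inequality: each unbalanced [S] contributes at least [d ^ 2] to [q ^ 2] times the
    sum of the squared deviations. *)
Lemma card_unbalanced q : 0 < d -> #|[set S | unbalanced q S]| * d <= q ^ 2 * 2 ^ d.
Proof.
move=> d0; rewrite -(leq_pmul2l d0).
rewrite -(ler_nat int) (_ : d * (q ^ 2 * 2 ^ d) = q ^ 2 * (d * 2 ^ d)); last by lia.
rewrite [X in (_ <= X)%R]natrM -sum_deviation2 mulr_sumr.
rewrite (bigID (fun S => unbalanced q S)) /=.
apply: le_trans (_ : (_ <= \sum_(S | unbalanced q S) (q ^ 2)%:R *
    (#|S|%:R *+ 2 - d%:R) ^+ 2)%R) _; last first.
  by rewrite lerDl sumr_ge0 // => S _; rewrite mulr_ge0 ?sqr_ge0 ?ler0n.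
have -> : ((d * (#|[set S | unbalanced q S]| * d))%:R =
    \sum_(S | unbalanced q S) (d ^ 2)%:R :> int)%R.
  rewrite sumr_const -mulrnA cardsE; congr (_%:R)%R.
  by rewrite mulnCA mulnn mulnC.
apply: ler_sum => S; rewrite /unbalanced => h.
set e := (_ *+ 2 - _)%R.
have -> : (e ^+ 2 = ((2 * #|S| - d) + (d - 2 * #|S|))%:R ^+ 2)%R.
  rewrite /e; case: (leqP d (2 * #|S|)) => h'.
    have -> : d - 2 * #|S| = 0 by apply/eqP; rewrite subn_eq0.
    by rewrite addn0 natrB // natrM mulr_natl.
  have -> : 2 * #|S| - d = 0 by apply/eqP; rewrite subn_eq0 ltnW.
  by rewrite add0n (natrB _ (ltnW h')) natrM mulr_natl -sqrrN opprB.
by rewrite -natrX -natrM ler_nat -expnMn leq_exp2r.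
Qed.

End Cube.

(** * Edge probability of a fixed pair *)

Section EdgeCounts.
Variables (R : realType) (d : nat).
Local Notation cube := (@cube_point R d).
Implicit Types (u v w : 'rV[bool]_d) (X A T : {set 'rV[bool]_d}).
Let N := 2 ^ d.

Definition is_halfspace T := exists (c : 'cV[R]_d) (b : R),
  forall u, (u \in T) = (lform c (cube u) < b)%R.

(** The coordinates of the sum of the points of [T]; together with [#|T|] they are the Chow
    parameters. *)
Definition coord_count T i := #|[set u in T | u 0%R i]|.

Lemma sum_lform T (c : 'cV[R]_d) (b : R) :
  (\sum_(u in T) (lform c (cube u) - b) =
   \sum_i (coord_count T i)%:R * c i 0 - #|T|%:R * b)%R.
Proof.
rewrite big_split /= sumr_const mulNrn mulr_natl; congr (_ - _)%R.
transitivity (\sum_(u in T) \sum_i (u 0 i)%:R * c i 0)%R.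
  apply: eq_bigr => u _; rewrite /lform mxE.
  by apply: eq_bigr => i _; rewrite mxE.
rewrite exchange_big; apply: eq_bigr => i _.
rewrite -mulr_suml -natr_sum; congr (_%:R * _)%R.
rewrite /coord_count -sum1_card big_mkcond [RHS]big_mkcond /=.
by apply: eq_bigr => u _; rewrite inE; case: (u \in T); case: (u 0%R i).
Qed.

(** The sums of [lform c - b] over [T] and [T'] depend only on the Chow parameters, so they agree.
    Once the common points are cancelled, a sum of negative terms over [T :\: T'] equals a sum of
    nonnegative ones, so [T :\: T'] is empty. *)
Lemma halfspace_sub T T' : is_halfspace T ->
  (forall i, coord_count T i = coord_count T' i) -> #|T| = #|T'| -> T \subset T'.
Proof.
move=> [c [b Tcb]] e1 e2; rewrite -finset.setD_eq0.
pose f u := (lform c (cube u) - b)%R.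
have : (\sum_(u in T) f u = \sum_(u in T') f u)%R.
  by rewrite !sum_lform e2; congr (_ - _)%R; apply: eq_bigr => i _; rewrite e1.
rewrite (big_setID T') [RHS](big_setID T) /= finset.setIC => /addrI e.
apply: contraT => /finset.set0Pn[u uD].
have : (\sum_(u in T :\: T') f u < 0)%R.
  rewrite (bigD1 u) //=.
  have fu u' : u' \in T :\: T' -> (f u' < 0)%R.
    by rewrite inE => /andP[_]; rewrite Tcb /f subr_lt0.
  apply: (@lt_le_trans _ _ (0 + 0)%R); last by rewrite addr0.
  apply: ltr_leD; first exact: fu.
  by apply: sumr_le0 => u' /andP[/fu/ltW].
rewrite e ltNge sumr_ge0 // => u' /[!inE] /andP[].
by rewrite Tcb -leNgt /f subr_ge0.
Qed.

Lemma card_halfspaces :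
  #|[set T : {set 'rV[bool]_d} | `[< is_halfspace T >] ]| <= N.+1 ^ d.+1.
Proof.
pose chow T : {ffun 'I_d -> 'I_N.+1} * 'I_N.+1 :=
  ([ffun i => inord (coord_count T i)], inord #|T|).
have cN T : #|T| < N.+1 by rewrite ltnS /N -card_cube max_card.
have inordE T T' : inord #|T| = inord #|T'| :> 'I_N.+1 -> #|T| = #|T'|.
  by move=> /(congr1 val); rewrite /= !inordK.
rewrite -(@card_in_imset _ _ chow); last first.
  move=> T T' /[!inE] hT hT' [/ffunP e1 e2].
  have e i : coord_count T i = coord_count T' i.
    by have := e1 i; rewrite !ffunE => /inordE.
  have eT := inordE _ _ e2.
  by apply/eqP; rewrite finset.eqEsubset (halfspace_sub hT e eT)
    (halfspace_sub hT' (fun i => esym (e i)) (esym eT)).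
apply: leq_trans (max_card _) _.
by rewrite card_prod card_ffun !card_ord expnSr.
Qed.

(** On [subcube v w] this is the reflection in its centre: it flips the coordinates where [v] and
    [w] differ. *)
Definition antipode v w u : 'rV[bool]_d := (\row_i (v 0 i (+) w 0 i (+) u 0 i))%R.

Lemma antipode_subcube v w u : u \in subcube v w -> antipode v w u \in subcube v w.
Proof.
rewrite !inE => /forallP h; apply/forallP => i; have := h i; rewrite mxE.
by case: (v 0%R i); case: (w 0%R i); case: (u 0%R i).
Qed.

Lemma antipode_inj v w : injective (antipode v w).
Proof.
move=> u u' /rowP e; apply/rowP => i; have := e i; rewrite !mxE.
by case: (v 0%R i); case: (w 0%R i); case: (u 0%R i); case: (u' 0%R i).
Qed.

Lemma lform_antipode (c : 'cV[R]_d) v w u : u \in subcube v w ->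
  (lform c (cube (antipode v w u)) + lform c (cube u) =
   lform c (cube v) + lform c (cube w))%R.
Proof.
rewrite inE => /forallP h; rewrite -!lformD; congr lform.
apply/rowP => i; have := h i; rewrite !mxE.
by case: (v 0%R i); case: (w 0%R i); case: (u 0%R i) => //= _; rewrite addrC.
Qed.

(** The values of the form at antipodal points add up to [2 * b], so the antipode of a point of [T]
    lies outside [T]. *)
Lemma half_subcube v w T (c : 'cV[R]_d) (b : R) :
    lform c (cube v) = b -> lform c (cube w) = b ->
    (forall u, (u \in T) = (lform c (cube u) < b)%R) ->
  2 ^ #|diffs v w| <= 2 * #|subcube v w :\: T|.
Proof.
move=> vb wb Tcb; rewrite -card_subcube -(cardsID T (subcube v w)) mul2n -addnn leq_add2r.
rewrite -(card_imset (subcube v w :&: T) (@antipode_inj v w)) subset_leq_card //.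
apply/fintype.subsetP => _ /imsetP[u + ->]; rewrite !finset.in_setI finset.in_setD => /andP[uF].
rewrite antipode_subcube // andbT !Tcb -leNgt.
have := lform_antipode c uF; rewrite vb wb => e ub.
by lra.
Qed.

Lemma card_supersets_avoiding A (B : {set 'rV[bool]_d}) b n :
    #|A| <= n -> [disjoint A & B] -> b <= #|B| ->
  #|[set X : {set 'rV[bool]_d} | [&& A \subset X, [disjoint X & B] & #|X| == n]]|
  <= 'C(N - #|A| - b, n - #|A|).
Proof.
move=> An AB bB; rewrite -{1}(subnKC An) card_supersets // card_cube leq_bin2l //.
by rewrite leq_sub2l.
Qed.

(** Union bound over the open halfspaces [T] on which a supporting form is below its maximum. [X]
    avoids [subcube v w :\: T] except for [v] and [w], hence the [- 2] after the division. *)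
Lemma card_edge_le v w n : v != w -> 2 <= n ->
  #|[set X : {set 'rV[bool]_d} | [&& [set v; w] \subset X, #|X| == n &
      `[< is_exposed R X [set v; w] >] ]]| <=
  N.+1 ^ d.+1 * 'C(N - 2 - (2 ^ #|diffs v w| %/ 2 - 2), n - 2).
Proof.
move=> vw n2; have c2 : #|[set v; w]| = 2 by rewrite cards2 vw.
pose k := 2 ^ #|diffs v w|.
pose B T := (subcube v w :\: T) :\: [set v; w].
pose H := [set T : {set 'rV[bool]_d} | `[< is_halfspace T >] ].
pose H' := [set T in H | k <= 2 * #|subcube v w :\: T|].
pose av T := [set X : {set 'rV[bool]_d} |
   [&& [set v; w] \subset X, [disjoint X & B T] & #|X| == n]].
apply: leq_trans (_ : \sum_(T in H') #|av T| <= _).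
  apply: leq_trans (_ : #|\bigcup_(T in H') av T| <= _); last first.
    exact: leq_card_bigcup.
  apply/subset_leq_card/fintype.subsetP => X; rewrite inE => /and3P[vwX Xn /asboolP].
  move=> [c [b [Xb vwE]]].
  have vb : lform c (cube v) = b.
    by have := set21 v w; rewrite vwE inE => /andP[_ /eqP].
  have wb : lform c (cube w) = b.
    by have := set22 v w; rewrite vwE inE => /andP[_ /eqP].
  pose T := [set u : 'rV[bool]_d | (lform c (cube u) < b)%R].
  have TE u : (u \in T) = (lform c (cube u) < b)%R by rewrite inE.
  apply/bigcupP; exists T.
    rewrite !inE; apply/andP; split; first by apply/asboolP; exists c, b.
    exact: half_subcube vb wb TE.
  rewrite inE vwX Xn andbT /=; apply/pred0P => u /=; apply/negbTE.
  apply/negP => /andP[uX]; rewrite /B finset.in_setD vwE inE uX /= finset.in_setD TE.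
  by rewrite -leNgt eq_le Xb //= => /and3P[/negP].
apply: leq_trans (_ : \sum_(T in H') 'C(N - 2 - (k %/ 2 - 2), n - 2) <= _).
  apply: leq_sum => T; rewrite finset.in_set => /andP[_ kT].
  have := @card_supersets_avoiding [set v; w] (B T) (k %/ 2 - 2) n.
  rewrite c2; apply => //.
    by rewrite disjoint_sym finset.disjoints_subset /B finset.setDE finset.subsetIr.
  rewrite /B cardsD; apply: leq_sub; first lia.
  by rewrite -[X in _ <= X]c2 subset_leq_card // finset.subsetIr.
rewrite sum_nat_const leq_mul2r; apply/orP; right.
apply: leq_trans _ card_halfspaces; apply/subset_leq_card/fintype.subsetP => T.
by rewrite /H' /H !finset.in_set => /andP[].
Qed.

(** If the subcube holds no third point of [X], it exposes the pair. The union bound runs over the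
    possible third points, each of conditional probability at most [n / N]. *)
Lemma card_nonedge_le v w n : v != w -> n <= N ->
  #|[set X : {set 'rV[bool]_d} | [&& [set v; w] \subset X, #|X| == n &
      ~~ `[< is_exposed R X [set v; w] >] ]]| * N <=
  2 ^ #|diffs v w| * n * 'C(N - 2, n - 2).
Proof.
move=> vw nN; have c2 : #|[set v; w]| = 2 by rewrite cards2 vw.
pose F := subcube v w :\: [set v; w].
pose sup u := [set X : {set 'rV[bool]_d} | (u |: [set v; w] \subset X) && (#|X| == n)].
set S := [set X | _].
have SF : S \subset \bigcup_(u in F) sup u.
  apply/fintype.subsetP => X; rewrite inE => /and3P[vwX Xn /asboolP nX].
  have vwF : [set v; w] \subset X :&: subcube v w.
    rewrite finset.subsetI vwX; apply/fintype.subsetP => u; rewrite !inE.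
    move=> /orP[] /eqP ->; apply/forallP => i; first by rewrite eqxx implybT.
    by rewrite eq_sym implybb.
  have /finset.set0Pn[u] : (X :&: subcube v w) :\: [set v; w] != finset.set0.
    apply/negP; rewrite finset.setD_eq0 => h; apply: nX.
    have -> : [set v; w] = X :&: subcube v w.
      by apply/eqP; rewrite finset.eqEsubset vwF h.
    exact: subcube_exposed.
  rewrite finset.in_setD finset.in_setI => /and3P[uvw uX uF].
  apply/bigcupP; exists u; first by rewrite finset.in_setD uvw uF.
  by rewrite inE Xn andbT finset.subUset vwX andbT finset.sub1set.
have supC u : u \in F -> 3 <= n -> #|sup u| = 'C(N - 3, n - 3).
  rewrite finset.in_setD => /andP[uvw _] n3.
  have c3 : #|u |: [set v; w]| = 3 by rewrite cardsU1 uvw c2.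
  have := card_supersets (n - 3) (disjoint_set0 (u |: [set v; w])).
  rewrite c3 cards0 subn0 card_cube subnKC // => <-.
  by apply: eq_card => X; rewrite !finset.inE disjoint_set0.
(* Below 3 the difference [n - 3] truncates to 0 and the binomial would be 1, although no third
   point fits into [X]. *)
case: (ltnP n 3) => n3.
  suff -> : S = finset.set0 by rewrite cards0.
  apply/eqP; rewrite -finset.subset0; apply: fintype.subset_trans SF _.
  apply/bigcupsP => u; rewrite finset.in_setD => /andP[uvw _].
  apply/fintype.subsetP => X; rewrite !inE => /andP[/subset_leq_card + /eqP Xn].
  by rewrite cardsU1 uvw c2 Xn leqNgt n3.
have SC : #|S| <= #|F| * 'C(N - 3, n - 3).
  apply: leq_trans (subset_leq_card SF) _; apply: leq_trans (leq_card_bigcup _ _) _.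
  rewrite -sum_nat_const; apply: leq_sum => u uF; by rewrite supC.
have Fk : #|F| <= 2 ^ #|diffs v w|.
  by rewrite -card_subcube subset_leq_card // finset.subsetDl.
rewrite -mulnA; apply: leq_trans (leq_mul Fk (bin_pred_le n3 nN)).
by rewrite mulnA leq_mul2r SC orbT.
Qed.

End EdgeCounts.

(** * Averaging over pairs *)

(** Since [D < (D %/ m.+1).+1 * m.+1 <= 2 ^ (D %/ m.+1) * m.+1], the power [D ^ m.+1] is at most
    [2 ^ D * m.+1 ^ m.+1]; one factor [D] absorbs [m.+1 ^ m.+1]. *)
Lemma expn_le_exp2n m D : m.+1 ^ m.+1 <= D -> D ^ m <= 2 ^ D.
Proof.
move=> mD; rewrite -(@leq_pmul2r (m.+1 ^ m.+1)) ?expn_gt0 //.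
apply: leq_trans (_ : D ^ m.+1 <= _); first by rewrite (expnSr D) leq_mul2l mD orbT.
apply: leq_trans (_ : (2 ^ (D %/ m.+1) * m.+1) ^ m.+1 <= _).
  rewrite leq_exp2r //; apply: leq_trans (leq_mul (ltn_expl (D %/ m.+1) (ltnSn 1)) (leqnn _)).
  exact/ltnW/ltn_ceil.
by rewrite expnMn leq_mul2r -expnM leq_pexp2l ?orbT // leq_divM.
Qed.

Section Averaging.
Variables (d : nat).
Implicit Types (A X : {set 'rV[bool]_d}).
Let N := 2 ^ d.

(** Unbalanced pairs are bounded trivially by [M], but Chebyshev makes them a fraction of at most
    [8 * q ^ 2 / d.+1]; each balanced pair contributes at most [M / d.+1]. *)
Lemma sum_pairs_le (g : {set 'rV[bool]_d} -> nat) q M : 0 < d ->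
    (forall A, #|A| = 2 -> g A <= M) ->
    (forall v w, v != w -> ~~ unbalanced q (diffs v w) ->
      g [set v; w] * d.+1 <= M) ->
  (\sum_(A in [set A : {set 'rV[bool]_d} | #|A| == 2]) g A) * d.+1 <=
  (8 * q ^ 2 + 1) * ('C(N, 2) * M).
Proof.
move=> d0 gM gU.
(* Ordered pairs are easy to count: fix [v] and let the set of differences vary. *)
pose V := [set vw : 'rV[bool]_d * 'rV[bool]_d | unbalanced q (diffs vw.1 vw.2)].
pose B := [set [set vw.1; vw.2] | vw in V].
have cV : #|V| * d <= q ^ 2 * N ^ 2.
  have -> : #|V| = N * #|[set S : {set 'I_d} | unbalanced q S]|.
    rewrite -sum1_card (eq_bigl (fun vw =>
      xpredT vw.1 && unbalanced q (diffs vw.1 vw.2))); last first.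
      by move=> vw; rewrite !finset.inE.
    rewrite -(pair_big_dep xpredT (fun v w => unbalanced q (diffs v w)) (fun _ _ => 1)) /=.
    under eq_bigr => v _.
      rewrite (reindex (flip v)) /=; last first.
        by exists (diffs v) => ? _; [exact: flipK|exact: diffsK].
      under eq_bigl do rewrite flipK.
      rewrite sum1_card; over.
    rewrite sum_nat_const /N -card_cube; congr (_ * _).
    by apply: eq_card => S; rewrite !finset.inE.
  by rewrite -mulnA (expnS N) expn1 [leqRHS]mulnCA leq_mul2l card_unbalanced ?orbT.
(* The 8 is a 2 from [d.+1 <= 2 * d] times a 4 from [N ^ 2 <= 4 * 'C(N, 2)]. *)
have cB : #|B| * d.+1 <= 8 * q ^ 2 * 'C(N, 2).
  have : #|B| <= #|V| by exact: leq_imset_card.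
  have : N ^ 2 <= 4 * 'C(N, 2).
    have N2 : 2 <= N by rewrite /N -{1}(expn1 2) leq_exp2l.
    by have := bin_ffact N 2; rewrite ffactnSr ffactn1 (_ : 2`! = 2) //; nia.
  nia.
rewrite big_distrl /= (bigID (mem B)) /=.
rewrite mulnDl mul1n leq_add //.
  apply: leq_trans (_ : \sum_(A in B) M * d.+1 <= _).
    rewrite [leqRHS](bigID (fun A => A \in [set A : {set 'rV[bool]_d} | #|A| == 2])) /=.
    apply: leq_trans (leq_addr _ _).
    under [leqRHS]eq_bigl do rewrite andbC.
    apply: leq_sum => A /andP[]; rewrite finset.inE => /eqP A2 _.
    by rewrite leq_mul2r gM.
  by rewrite sum_nat_const mulnCA [leqRHS]mulnA [leqRHS]mulnC leq_mul2l cB orbT.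
apply: leq_trans (_ : \sum_(A in [set A : {set 'rV[bool]_d} | #|A| == 2]) M <= _).
  rewrite [leqRHS](bigID (mem B)) /=; apply: leq_trans (leq_addl _ _).
  apply: leq_sum => A /andP[]; rewrite finset.inE => /cards2P[v [w [vw ->]]] nB.
  apply: gU => //; apply: contra nB => U; apply/imsetP; exists (v, w) => //.
  by rewrite finset.inE.
rewrite sum_nat_const leq_mul2r; apply/orP; right.
rewrite /N -card_cube -cardsT -cards_draws subset_leq_card //.
by apply/fintype.subsetP => A; rewrite !finset.inE finset.subsetT.
Qed.

End Averaging.

(** * The expected density and its two bounds *)

Section ExpectedDensity.
Variables (R : realType) (d n : nat).
Hypotheses (n_gt1 : 2 <= n) (n_le : n <= 2 ^ d).
Let N := 2 ^ d.
Let M := 'C(N - 2, n - 2).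
Implicit Types (A X : {set 'rV[bool]_d}).

Definition edge_count A := #|[set X : {set 'rV[bool]_d} |
  [&& A \subset X, #|X| == n & `[< is_exposed R X A >] ]]|.

Definition nonedge_count A := #|[set X : {set 'rV[bool]_d} |
  [&& A \subset X, #|X| == n & ~~ `[< is_exposed R X A >] ]]|.

Lemma edge_nonedge_count A : #|A| = 2 -> edge_count A + nonedge_count A = M.
Proof.
move=> A2; have := card_supersets (n - 2) (disjoint_set0 A).
rewrite A2 cards0 subn0 card_cube subnKC // /M /N => <-.
rewrite -(cardsID [set X | `[< is_exposed R X A >]]); congr (_ + _);
  by apply: eq_card => X; rewrite !finset.inE disjoint_set0 ?andbT;
  case: (A \subset X); case: (#|X| == n); case: (`[< _ >]).
Qed.

(** Linearity of expectation: [edge_count A / M] is the probability that the pair [A] is an edge,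
    given that [X] contains it. *)
Lemma expected_densityE : expected_density R d n =
  ((\sum_(A in [set A : {set 'rV[bool]_d} | #|A| == 2]) edge_count A)%:R /
   ('C(N, 2) * M)%:R)%R.
Proof.
rewrite /expected_density /unif_expectation.
have -> : #|[set X : {set 'rV[bool]_d} | #|X| == n]| = 'C(N, n).
  rewrite /N -card_cube -cardsT -cards_draws.
  by apply: eq_card => X; rewrite !finset.inE finset.subsetT.
have -> : (\sum_(X in [set X : {set 'rV[bool]_d} | #|X| == n]) graph_density (polytope01 X) =
   (\sum_(X in [set X : {set 'rV[bool]_d} | #|X| == n]) #|edge_pairs R X|)%:R / 'C(n, 2)%:R :> R)%R.
  rewrite natr_sum mulr_suml; apply: eq_bigr => X; rewrite finset.inE => /eqP Xn.
  by rewrite graph_density_polytope Xn.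
rewrite -mulrA -invfM -natrM mulnC.
rewrite /M /N -card_cube -exchange_card_pairs // mulnC card_cube.
congr (_%:R / _)%R; rewrite -exchange_card_subsets; apply: eq_bigr => X _.
apply: eq_card => A; rewrite !finset.inE.
case: asboolP => [/is_exposed_sub ->|]; by rewrite ?andbT ?andbF.
Qed.

Lemma pair_count_gt0 : 0 < 'C(N, 2) * M.
Proof.
have N2 : 2 <= N by exact: leq_trans n_le.
by rewrite muln_gt0 !bin_gt0 N2 leq_sub2r.
Qed.

Lemma nonedge_sum :
  (1 - expected_density R d n =
  (\sum_(A in [set A : {set 'rV[bool]_d} | #|A| == 2]) nonedge_count A)%:R /
   ('C(N, 2) * M)%:R)%R.
Proof.
rewrite expected_densityE; set e := bigop _ _ _; set e' := bigop _ _ _.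
have h : e + e' = 'C(N, 2) * M.
  rewrite -big_split /= (eq_bigr (fun=> M)); last first.
    by move=> A; rewrite finset.inE => /eqP /edge_nonedge_count.
  rewrite sum_nat_const; congr (_ * _); rewrite /N -card_cube -cardsT -cards_draws.
  by apply: eq_card => X; rewrite !finset.inE finset.subsetT.
have K0 : (('C(N, 2) * M)%:R != 0 :> R)%R by rewrite pnatr_eq0 -lt0n pair_count_gt0.
by rewrite -{1}(divff K0) -mulrBl -h natrD addrC addKr.
Qed.

(** [harmonic d] is [1 / d.+1], which is why the counts are scaled by [d.+1]. *)
Lemma mean_le (S q : nat) : S * d.+1 <= (8 * q ^ 2 + 1) * ('C(N, 2) * M) ->
  (S%:R / ('C(N, 2) * M)%:R <= (8 * q ^ 2 + 1)%:R * harmonic d :> R)%R.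
Proof.
move=> h; rewrite ler_pdivrMr ?ltr0n ?pair_count_gt0 // /harmonic /= mulrAC.
by rewrite ler_pdivlMr ?ltr0n // -!natrM ler_nat.
Qed.

Lemma expected_density_ge0 : (0 <= expected_density R d n)%R.
Proof. by rewrite expected_densityE divr_ge0 ?ler0n. Qed.

Lemma expected_density_le1 : (expected_density R d n <= 1)%R.
Proof. by rewrite -subr_ge0 nonedge_sum divr_ge0 ?ler0n. Qed.

(** The hypothesis on [n] reads [n <= 2 ^ (d / 2 - d / q)], and balanced pairs have
    [k <= d / 2 + d / (2 * q)]. So [2 ^ k * n / N] is at most [2 ^ (- d / (2 * q))], hence at most
    [1 / d.+1]. Taking powers with exponent [2 * q] clears the denominators. *)
Lemma expected_density_ge q : 0 < d ->
    (n ^ (2 * q) * 4 ^ d <= 2 ^ (q * d)) -> d.+1 ^ (2 * q) <= 2 ^ d -> 0 < q ->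
  (1 - (8 * q ^ 2 + 1)%:R * harmonic d <= expected_density R d n)%R.
Proof.
move=> d0 nq dq q0; rewrite lerBlDl -lerBlDr nonedge_sum; apply: mean_le.
apply: sum_pairs_le => // [A /edge_nonedge_count <-|v w vw bal]; first exact: leq_addl.
set k := #|diffs v w|.
have kq : 2 * q * k <= (q + 1) * d.
  by move: bal; rewrite /unbalanced -ltnNge -/k; nia.
have kn : 2 ^ k * n * d.+1 <= N.
  rewrite -(@leq_exp2r _ _ (2 * q)) ?muln_gt0 //.
  rewrite -(@leq_pmul2r (4 ^ d)) ?expn_gt0 //.
  have ka : (2 ^ k) ^ (2 * q) <= 2 ^ ((q + 1) * d) by rewrite -expnM leq_pexp2l // mulnC.
  have -> : (2 ^ k * n * d.+1) ^ (2 * q) * 4 ^ d =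
      (2 ^ k) ^ (2 * q) * (n ^ (2 * q) * 4 ^ d) * d.+1 ^ (2 * q).
    by rewrite 2!(expnMn _ _ (2 * q)) mulnAC !mulnA.
  apply: leq_trans (leq_mul (leq_mul ka nq) dq) _.
  rewrite -[4]/(2 ^ 2) /N -!expnM -!expnD leq_pexp2l //; nia.
have := @card_nonedge_le R d v w n vw n_le; rewrite -/k -/(nonedge_count _) => h.
have N0 : 0 < N by rewrite expn_gt0.
rewrite -(leq_pmul2r N0) mulnAC.
apply: leq_trans (leq_mul h (leqnn d.+1)) _.
by rewrite mulnAC [leqRHS]mulnC; exact: leq_mul kn (leqnn _).
Qed.

(** Now [n >= 2 ^ (d / 2 + d / q)] and [k >= d / 2 - d / (2 * q)], so [2 ^ k * n] is at least
    [8 * (d + 2) ^ 2 * N]. For each halfspace the avoidance probability is then at most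
    [expR (- (d + 2) ^ 2)], which beats the number of halfspaces times [d.+1]. *)
Lemma expected_density_le q : 0 < d ->
    (2 ^ (q * d) * 4 ^ d <= n ^ (2 * q)) ->
    (8 * (d + 2) ^ 2) ^ (2 * q) <= 2 ^ d -> 0 < q ->
  (expected_density R d n <= (8 * q ^ 2 + 1)%:R * harmonic d)%R.
Proof.
move=> d0 nq dq q0; rewrite expected_densityE; apply: mean_le.
apply: sum_pairs_le => // [A /edge_nonedge_count <-|v w vw bal]; first exact: leq_addr.
set k := #|diffs v w|.
have kq : q * d <= 2 * q * k + d.
  by move: bal; rewrite /unbalanced -ltnNge -/k; nia.
have kn : 8 * (d + 2) ^ 2 * N <= 2 ^ k * n.
  rewrite -(@leq_exp2r _ _ (2 * q)) ?muln_gt0 // [leqLHS]expnMn [leqRHS]expnMn.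
  apply: leq_trans (leq_mul (leqnn _) nq).
  apply: leq_trans (leq_mul dq (leqnn _)) _.
  rewrite -[4]/(2 ^ 2) /N -!expnM -!expnD leq_pexp2l //; nia.
have kd : k <= d by rewrite -[leqRHS]card_ord max_card.
have kN : 2 ^ k <= N by rewrite leq_pexp2l.
pose b := 2 ^ k %/ 2 - 2.
have N0 : 0 < N by rewrite expn_gt0.
(* As [n] and [2 ^ k] are both at most [N], each is at least [8 * (d + 2) ^ 2] by [kn]. *)
have k8 : 32 <= 2 ^ k by move: kn n_le; rewrite -/N; nia.
have n8 : 32 <= n by move: kn; nia.
(* The factor 8 in [kn] pays for [b >= 2 ^ k / 4] and [n - 2 >= n / 2]. *)
have bn : (d + 2) ^ 2 * (N - 2) <= b * (n - 2).
  apply: leq_trans (_ : (d + 2) ^ 2 * N <= _); first by rewrite leq_mul2l leq_subr orbT.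
  have b4 : 2 ^ k <= 4 * b by rewrite /b; lia.
  have n4 : n <= 2 * (n - 2) by lia.
  nia.
have bN : b <= N - 2 by rewrite /b; lia.
have := @card_edge_le R d v w n vw n_gt1; rewrite -/(edge_count _) -/b -/N => h.
apply: leq_trans (leq_mul h (leqnn d.+1)) _.
have N2 : (0 < (N - 2)%:R :> R)%R by rewrite ltr0n; lia.
rewrite -(ler_nat R) -(ler_pM2r (exprn_gt0 (n - 2) N2)) -!natrX -!natrM.
rewrite (_ : _ * _ * _ * _ = N.+1 ^ d.+1 * d.+1 * ('C(N - 2 - b, n - 2) *
  (N - 2) ^ (n - 2))); last by lia.
rewrite natrM; apply: le_trans (_ : _ <=
   (N.+1 ^ d.+1 * d.+1)%:R * ('C(N - 2, n - 2) * (N - 2 - b) ^ (n - 2))%:R)%R _.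
  by rewrite ler_wpM2l ?ler0n // ler_nat bin_sub_le.
rewrite !natrM mulrCA ler_wpM2l ?ler0n // !natrX natrB //.
set x := (b%:R / (N - 2)%:R : R)%R.
have -> : ((N - 2)%:R - b%:R = (1 - x) * (N - 2)%:R :> R)%R.
  by rewrite mulrBl mul1r divfK // gt_eqF.
rewrite exprMn mulrA ler_piMl ?exprn_ge0 ?ler0n //.
have x1 : (0 <= 1 - x)%R by rewrite subr_ge0 ler_pdivrMr // mul1r ler_nat.
have ex : ((1 - x) ^+ (n - 2) <= expR (- ((d + 2) ^ 2)%:R))%R.
  apply: le_trans (_ : expR (- x) ^+ (n - 2) <= _)%R.
    by rewrite lerXn2r ?nnegrE ?expR_ge0 // expR_ge1Dx.
  rewrite -expRM_natl ler_expR mulrN lerN2 /x mulrA ler_pdivlMr // -!natrM ler_nat.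
  by rewrite [leqRHS]mulnC.
(* By [N.+1 <= 2 ^ d.+1] and [d.+1 <= 2 ^ d] the left side is at most 2 to the power [d.+1 ^ 2 + d];
   then 2 is replaced by [expR 1]. *)
have e1 : ((N.+1 ^ d.+1 * d.+1)%:R <= expR ((d + 2) ^ 2)%:R :> R)%R.
  apply: le_trans (_ : (2 ^ ((d + 2) ^ 2))%:R <= _)%R.
    rewrite ler_nat; apply: leq_trans (_ : (2 ^ d.+1) ^ d.+1 * 2 ^ d <= _).
      apply: leq_mul; last exact: ltn_expl.
      by rewrite leq_exp2r // expnS -/N mul2n -addnn -addn1 leq_add2l.
    rewrite -expnM -expnD leq_pexp2l //; nia.
  rewrite natrX -[X in expR X]mulr1 expRM_natl lerXn2r ?nnegrE ?expR_ge0 ?ler0n //.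
  by apply: le_trans (expR_ge1Dx _); rewrite -natr1.
rewrite -natrX -natrM; apply: le_trans (ler_pM _ _ e1 ex) _; rewrite ?ler0n ?exprn_ge0 //.
by rewrite -expRD subrr expR0.
Qed.

End ExpectedDensity.

(** * Limits *)

Local Open Scope classical_set_scope.

Lemma near_poly_le_exp2n q :
  \forall d \near \oo, ((8 * (d + 2) ^ 2) ^ (2 * q) <= 2 ^ d)%N.
Proof.
(* The threshold of [expn_le_exp2n] for the exponent [5 * (2 * q)], plus 4 to ensure
   [8 * (d + 2) ^ 2 <= d ^ 5]. *)
exists ((5 * (2 * q)).+1 ^ (5 * (2 * q)).+1 + 4)%N => //= d qd.
apply: leq_trans (_ : (d ^ 5) ^ (2 * q) <= _)%N.
  case: q {qd} (leq_trans (leq_addl _ 4) qd) => [|q] d4; first by rewrite !expn0.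
  rewrite leq_exp2r //; apply: leq_trans (_ : 8 * (2 * d) ^ 2 <= _)%N.
    by rewrite leq_mul2l leq_exp2r // mul2n -addnn leq_add2l (leq_trans _ d4).
  rewrite expnMn mulnA (expnD d 3 2) leq_mul2r; apply/orP; right.
  by apply: leq_trans (_ : 4 ^ 3 <= _)%N; rewrite ?leq_exp2r.
by rewrite -expnM expn_le_exp2n // (leq_trans (leq_addr _ _) qd).
Qed.

Local Open Scope ring_scope.

(** Bernoulli's inequality. The 4 is the base of the slack [4 ^ d] in the density bounds. *)
Lemma exists_expr_ge4 (R : realType) (r : R) : 1 < r ->
  exists2 q, (0 < q)%N & 4 <= r ^+ q.
Proof.
move=> r1; have bern q : 1 + q%:R * (r - 1) <= r ^+ q.
  elim: q => [|q IH]; first by rewrite mul0r addr0.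
  have h : 0 <= q%:R * (r - 1) by rewrite mulr_ge0 ?ler0n // subr_ge0 ltW.
  rewrite exprS -natr1; apply: le_trans (ler_wpM2l _ IH); first nra.
  by rewrite ltW // (lt_trans ltr01).
exists (Num.bound (3 / (r - 1))).+1 => //.
apply: le_trans (bern _).
have r0 : 0 < r - 1 by rewrite subr_gt0.
have : 3 / (r - 1) < (Num.bound (3 / (r - 1)))%:R.
  by rewrite archi_boundP // divr_ge0 // ltW.
rewrite ltr_pdivrMr // -natr1; nra.
Qed.

Section Thresholds.
Variables (R : realType) (n : nat -> nat) (a : R).
Hypothesis a_gt0 : 0 < a.

(** This fixes [q]: if [(2 / a ^+ 2) ^+ q >= 4], then [a ^+ (2 * q) * 4 <= 2 ^+ q], whose [d]-th
    power gives the claim. *)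
Lemma near_below : a < Num.sqrt 2 -> (\forall d \near \oo, (n d)%:R <= a ^+ d) ->
  exists2 q, (0 < q)%N &
    \forall d \near \oo, (n d ^ (2 * q) * 4 ^ d <= 2 ^ (q * d))%N.
Proof.
move=> a2 na; have a2' : a ^+ 2 < 2.
  by rewrite -[ltRHS](@sqr_sqrtr _ 2) // ltrXn2r ?nnegrE ?sqrtr_ge0 // ltW.
have [|q q0 hq] := @exists_expr_ge4 _ (2 / a ^+ 2).
  by rewrite ltr_pdivlMr ?exprn_gt0 // mul1r.
exists q => //; near=> d.
have nd : (n d)%:R <= a ^+ d by near: d.
rewrite -(ler_nat R) natrM !natrX.
apply: le_trans (_ : (a ^+ d) ^+ (2 * q) * 4 ^+ d <= _).
  by rewrite ler_wpM2r ?exprn_ge0 // lerXn2r ?nnegrE ?ler0n // exprn_ge0 // ltW.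
rewrite -exprM mulnC exprM [2 ^+ (q * d)]exprM -exprMn.
rewrite lerXn2r ?nnegrE ?mulr_ge0 ?exprn_ge0 //; first exact: ltW.
rewrite exprM mulrC -ler_pdivlMr ?exprn_gt0 // -expr_div_n //.

Unshelve. all: by end_near. Qed.

Lemma near_above : Num.sqrt 2 < a -> (\forall d \near \oo, a ^+ d <= (n d)%:R) ->
  exists2 q, (0 < q)%N &
    \forall d \near \oo, (2 ^ (q * d) * 4 ^ d <= n d ^ (2 * q))%N.
Proof.
move=> a2 na; have a2' : 2 < a ^+ 2.
  by rewrite -[ltLHS](@sqr_sqrtr _ 2) // ltrXn2r ?nnegrE ?sqrtr_ge0 // ltW.
have [|q q0 hq] := @exists_expr_ge4 _ (a ^+ 2 / 2).
  by rewrite ltr_pdivlMr // mul1r.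
exists q => //; near=> d.
have nd : a ^+ d <= (n d)%:R by near: d.
rewrite -(ler_nat R) natrM !natrX.
apply: le_trans (_ : (a ^+ d) ^+ (2 * q) <= _); last first.
  by rewrite lerXn2r ?nnegrE ?ler0n // exprn_ge0 // ltW.
rewrite -exprM [(d * _)%N]mulnC [a ^+ _]exprM exprM -exprMn.
rewrite lerXn2r ?nnegrE ?mulr_ge0 ?exprn_ge0 //; first exact: ltW.
rewrite exprM mulrC -ler_pdivlMr ?exprn_gt0 // -expr_div_n //.
Unshelve. all: by end_near. Qed.

End Thresholds.

Lemma cvg_cst_harmonic (R : realType) (c : R) : c * harmonic d @[d --> \oo] --> 0.
Proof.
rewrite -[X in _ --> X](mulr0 c).
by apply: cvgM; [exact: cvg_cst|exact: cvg_harmonic].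
Qed.

(** [n_le] makes subsets with [n d] elements exist. With fewer than two vertices the density is 0 /
    0, that is 0, so the limit 1 requires [2 <= n d] eventually; for the limit 0 the growth of [n]
    already implies it. *)
Theorem theorem1 (R : realType) (n : nat -> nat)
  (n_le : forall d : nat, (n d <= 2 ^ d)%N) :
  ((exists2 eps : R, 0 < eps &
       \forall d \near \oo, (n d)%:R <= (Num.sqrt 2 - eps) ^+ d) ->
     (\forall d \near \oo, (2 <= n d)%N) ->
     (fun d : nat => expected_density R d (n d)) @ \oo --> (1 : R)) /\
  ((exists2 eps : R, 0 < eps &
       \forall d \near \oo, (n d)%:R >= (Num.sqrt 2 + eps) ^+ d) ->
     (fun d : nat => expected_density R d (n d)) @ \oo --> (0 : R)).
Proof.
split=> [[eps eps0 small] n2|[eps eps0 large]].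
  (* If the base were not positive, an odd [d] beyond both thresholds would give [n d <= 0], against
     [2 <= n d]. *)
  have a0 : 0 < Num.sqrt 2 - eps :> R.
    case: small n2 => D1 _ h1 [D2 _ h2].
    pose d := (D1 + D2).*2.+1.
    have := h1 d; have := h2 d; rewrite /d /= => n2 nd.
    have {n2}n2 : (2 <= n d)%N by apply: n2; lia.
    have {}nd : (n d)%:R <= (Num.sqrt 2 - eps) ^+ d by apply: nd; rewrite /=; lia.
    rewrite ltNge; apply/negP => a0.
    have : (Num.sqrt 2 - eps) ^+ d <= 0 by rewrite exprn_odd_le0 //= odd_double.
    by apply/negP; rewrite -ltNge (lt_le_trans _ nd) // ltr0n; lia.
  have [|q q0 hq] := near_below a0 _ small; first by rewrite ltrBlDr ltrDl.
  apply: (@squeeze_cvgr _ _ _ _ (fun d => 1 - (8 * q ^ 2 + 1)%:R * harmonic d) (fun=> 1)).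
  - near=> d; have n2d : (2 <= n d)%N by near: d.
    apply/andP; split; last exact: expected_density_le1.
    have d0 : (0 < d)%N by near: d; exists 1%N.
    apply: expected_density_ge => //; first by near: d.
    apply: leq_trans (_ : (8 * (d + 2) ^ 2) ^ (2 * q) <= _)%N.
      by rewrite leq_exp2r ?muln_gt0 //; nia.
    by near: d; exact: near_poly_le_exp2n.
  - rewrite -[X in _ --> X]subr0; apply: cvgB; first exact: cvg_cst.
    exact: cvg_cst_harmonic.
  - exact: cvg_cst.
have a0 : 0 < Num.sqrt 2 + eps :> R by rewrite ltr_wpDl ?sqrtr_ge0.
have [|q q0 hq] := near_above a0 _ large; first by rewrite ltrDl.
apply: (@squeeze_cvgr _ _ _ _ (fun=> 0) (fun d => (8 * q ^ 2 + 1)%:R * harmonic d)).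
- near=> d.
  have d0 : (0 < d)%N by near: d; exists 1%N.
  have nd : (2 ^ (q * d) * 4 ^ d <= n d ^ (2 * q))%N by near: d.
  (* Otherwise [n d ^ (2 * q)] would be at most 1, which is below the left side of [nd]. *)
  have n2d : (2 <= n d)%N.
    rewrite ltnNge; apply/negP => n1; move: nd; apply/negP; rewrite -ltnNge.
    apply: leq_ltn_trans (_ : 1 < _)%N.
      by rewrite -[leqRHS](exp1n (2 * q)) leq_exp2r ?muln_gt0.
    by rewrite -[4%N]/(2 ^ 2)%N -expnM -expnD -{1}(expn0 2) ltn_exp2l //; lia.
  apply/andP; split; first exact: expected_density_ge0.
  apply: expected_density_le => //.
  by near: d; exact: near_poly_le_exp2n.
- exact: cvg_cst.
- exact: cvg_cst_harmonic.
Unshelve. all: by end_near. Qed.
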